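(* Let $\{G_n\}$ be a Gibonacci sequence and let $\{G'_n\}$ be the associated modified Gibonacci sequence. For all integers $n\geq 2$ and all positive integers $N\leq n$, $$G_NG'_{n-N}+G_{N-1}G'_{n-N-1}= G_0G_{n-1}+G_1G_{n-2}= G_1G'_{n-1}+G_0G'_{n-2}.$$
   Context: A Gibonacci sequence is a sequence satisfying $G_n=G_{n-1}+G_{n-2}$, with initial values $G_0,G_1$ chosen freely (here arbitrary integers). The associated modified Gibonacci sequence is defined by $G'_0=G_1$, $G'_1=G_0$ and $G'_n=G'_{n-1}+G'_{n-2}$. Both sequences are extended to negative indices by the recurrence, so that $G'_{-1}=G_0-G_1$. *)

(* Defs.v *)
(* Mathematical Components; sequences are indexed by all of Z, since the
   recurrence is used to extend them to negative indices. *)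
From HB Require Import structures.
From mathcomp Require Import all_boot all_order all_algebra.

Set Implicit Arguments.
Unset Strict Implicit.
Unset Printing Implicit Defensive.

Import Order.TTheory GRing.Theory Num.Theory.
Local Open Scope ring_scope.

Definition gibonacci (G : int -> int) : Prop :=
  forall n : int, G n = G (n - 1) + G (n - 2).

(* For a given G, these conditions determine G' uniquely on Z. *)
Definition modified_gibonacci (G G' : int -> int) : Prop :=
  [/\ G' 0 = G 1, G' 1 = G 0 & gibonacci G'].

(* Main.v *)
Require Import Defs.
From HB Require Import structures.
From mathcomp Require Import all_boot all_order all_algebra.
From mathcomp Require Import ring.

Set Implicit Arguments.
Unset Strict Implicit.
Unset Printing Implicit Defensive.

Import Order.TTheory GRing.Theory Num.Theory.
Local Open Scope ring_scope.

(** For two sequences satisfying the Fibonacci recurrence, the sum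
    A k * B (n - k) + A (k - 1) * B (n - k - 1) does not change when k becomes
    k + 1: expanding A (k + 1) in one sum and B (n - k) in the other yields the
    same three products ([gibonacci_conv_const]).  With A = G and B = G', the
    three members of the claim are the values of this constant at k = N, k = n
    and k = 1; at k = n the initial values G' 0 = G 1 and
    G' (-1) = G 0 - G 1 turn the sum into the middle member. *)

Lemma int_shift_const (T : Type) (f : int -> T) :
  (forall k, f (k + 1) = f k) -> forall k m, f k = f m.
Proof.
move=> fS; suff f0 k : f k = f 0 by move=> k m; rewrite !f0.
elim/int_ind: k => [//|k IHk|k IHk].
  by rewrite -addn1 PoszD fS.
by rewrite -IHk -[LHS]fS; congr f; rewrite -addn1 PoszD; ring.
Qed.

Lemma gibonacci_conv_const (A B : int -> int) (n k m : int) :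
  gibonacci A -> gibonacci B ->
  A k * B (n - k) + A (k - 1) * B (n - k - 1) =
  A m * B (n - m) + A (m - 1) * B (n - m - 1).
Proof.
move=> hA hB; move: k m.
apply: (int_shift_const (f := fun k =>
  A k * B (n - k) + A (k - 1) * B (n - k - 1))) => k.
rewrite (hA (k + 1)) (hB (n - k)).
have -> : k + 1 - 1 = k by ring.
have -> : k + 1 - 2 = k - 1 by ring.
have -> : n - (k + 1) - 1 = n - k - 2 by ring.
have -> : n - (k + 1) = n - k - 1 by ring.
by ring.
Qed.

Theorem mainTheorem6 (G G' : int -> int)
    (hG : gibonacci G) (hG' : modified_gibonacci G G')
    (n N : int) (hn : 2 <= n) (hN : 0 < N) (hNn : N <= n) :
  G N * G' (n - N) + G (N - 1) * G' (n - N - 1)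
    = G 0 * G (n - 1) + G 1 * G (n - 2)
  /\ G 0 * G (n - 1) + G 1 * G (n - 2)
    = G 1 * G' (n - 1) + G 0 * G' (n - 2).
Proof.
have [G'0 G'1 rG'] := hG'.
have G'N1 : G' (-1) = G 0 - G 1.
  have := rG' 1; rewrite subrr G'0 G'1.
  by have -> : 1 - 2 = -1 :> int by []; move=> ->; ring.
have conv_n : G n * G' (n - n) + G (n - 1) * G' (n - n - 1)
    = G 0 * G (n - 1) + G 1 * G (n - 2).
  by rewrite subrr sub0r G'0 G'N1 (hG n); ring.
split; first by rewrite -conv_n; apply: gibonacci_conv_const.
rewrite -conv_n (gibonacci_conv_const n n 1 hG rG') subrr.
by have -> : n - 1 - 1 = n - 2 by ring.
Qed.
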